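(* Every class of graphs with low twin-width covers is weakly $\chi_p$-bounded for every positive integer $p$.
   Context: All graphs are finite, simple and undirected. Twin-width: a trigraph has a vertex set and two disjoint sets of edges, black and red. Contracting two (not necessarily adjacent) vertices $u,v$ of a trigraph replaces them by a new vertex $w$; for every other vertex $x$, the edge $wx$ is black if both $ux$ and $vx$ are black edges, absent if $x$ is adjacent (by any edge) to neither $u$ nor $v$, and red otherwise; all other edges are unchanged. The twin-width of a graph $G$ is the least $d$ such that there is a sequence of contractions from $G$ (all edges black) to a one-vertex graph in which every trigraph has red degree at most $d$ at every vertex. A class $\mathscr C$ has low twin-width covers if for every positive integer $p$ there are a constant $C_p$ and an integer $n_p$ such that for every $G\in\mathscr C$ there is a family $\mathcal F$ of at most $n_p$ subsets of $V(G)$ such that every set of at most $p$ vertices of $G$ is included in some member of $\mathcal F$, and every member of $\mathcal F$ induces a subgraph of $G$ of twin-width at most $C_p$. $\omega$ is the clique number; for a class $\mathscr D$, $\omega(\mathscr D)=\sup_{G\in\mathscr D}\omega(G)$. ${\rm TM}_r(G)$ is the class of all graphs $H$ such that some graph obtained from $H$ by subdividing each edge by at most $r$ vertices is a subgraph of $G$. The tree-depth ${\rm td}(G)$ is the minimum height (number of vertices on a longest root-to-leaf path) of a rooted forest $Y$ such that $G$ is a subgraph of the closure of $Y$ (the graph in which each vertex is adjacent to all its ancestors in $Y$). $\chi_p(G)$ is the minimum number of colors in a vertex coloring of $G$ such that every set $I$ of at most $p$ colors induces a subgraph of tree-depth at most $|I|$. A class $\mathscr C$ is weakly $\chi_p$-bounded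 if there is a function $g_p$ with $\chi_p(G)\leq g_p(\omega({\rm TM}_{p-1}(G)))$ for every $G\in\mathscr C$. *)

(* Defs.v *)
From HB Require Import structures.
From mathcomp Require Import all_boot.
From mathcomp Require Import boolp.

Set Implicit Arguments.
Unset Strict Implicit.
Unset Printing Implicit Defensive.

Definition least (P : nat -> Prop) (exP : exists n, P n) : nat :=
  ex_minn (P := fun n => `[< P n >])
    (let: ex_intro n Pn := exP in ex_intro _ n (asboolT Pn)).

Lemma leastP (P : nat -> Prop) (exP : exists n, P n) :
  P (least exP) /\ (forall m, P m -> least exP <= m).
Proof.
rewrite /least; case: ex_minnP => n /asboolP Pn min_n; split=> // m Pm.
exact/min_n/asboolP.
Qed.

(** * Graphs *)

Record graph := Graph {
  vertex :> finType;
  adj : rel vertex;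
  adj_sym : symmetric adj;
  adj_irr : irreflexive adj }.
Arguments adj {g} x y.

(* Not necessarily induced, up to isomorphism. *)
Definition subgraph (H G : graph) : Prop :=
  exists f : H -> G, injective f /\ forall x y : H, adj x y -> adj (f x) (f y).

Section Induced.
Variables (G : graph) (A : {set G}).

Definition induced_adj : rel {x : G | x \in A} :=
  fun x y => adj (val x) (val y).

Lemma induced_adj_sym : symmetric induced_adj.
Proof. by move=> x y; exact: adj_sym. Qed.

Lemma induced_adj_irr : irreflexive induced_adj.
Proof. by move=> x; exact: adj_irr. Qed.

Definition induced : graph := Graph induced_adj_sym induced_adj_irr.
End Induced.

Definition clique (G : graph) (A : {set G}) : bool :=
  [forall x in A, forall y in A, (x != y) ==> adj x y].

Definition omega (G : graph) : nat := \max_(A : {set G} | clique A) #|A|.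

(* A class need not be closed under isomorphism. *)
Definition graph_class := graph -> Prop.

(* The supremum of the clique numbers, for a class in which they are bounded. *)
Definition class_omega (D : graph_class)
    (bD : exists n, forall H, D H -> omega H <= n) : nat :=
  least bD.

(** * Twin-width *)

Record trigraph := Trigraph {
  tvertex :> finType;
  black : rel tvertex;
  red : rel tvertex;
  black_sym : symmetric black;
  black_irr : irreflexive black;
  red_sym : symmetric red;
  red_irr : irreflexive red;
  black_red_disj : forall x y, ~~ (black x y && red x y) }.
Arguments black {t} x y.
Arguments red {t} x y.

Section GraphTrigraph.
Variable G : graph.

Definition no_red : rel G := fun _ _ => false.

Lemma no_red_sym : symmetric no_red. Proof. by []. Qed.
Lemma no_red_irr : irreflexive no_red. Proof. by []. Qed.
Lemma no_red_disj (x y : G) : ~~ (adj x y && no_red x y).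
Proof. by rewrite andbF. Qed.

Definition trigraph_of_graph : trigraph :=
  Trigraph (@adj_sym G) (@adj_irr G) no_red_sym no_red_irr no_red_disj.
End GraphTrigraph.

Section Contract.
Variables (T : trigraph) (u v : T).

(* [None] is the new vertex, [Some x] an old vertex other than [u] and [v]. *)
Definition contract_vertex : finType := option {x : T | (x != u) && (x != v)}.

Definition new_black (x : T) : bool := black u x && black v x.

Definition new_red (x : T) : bool :=
  ~~ new_black x && [|| black u x, red u x, black v x | red v x].

Definition contract_black : rel contract_vertex := fun a b =>
  match a, b with
  | Some x, Some y => black (val x) (val y)
  | Some x, None | None, Some x => new_black (val x)
  | None, None => false
  end.

Definition contract_red : rel contract_vertex := fun a b =>
  match a, b with
  | Some x, Some y => red (val x) (val y)
  | Some x, None | None, Some x => new_red (val x)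
  | None, None => false
  end.

Lemma contract_black_sym : symmetric contract_black.
Proof. by move=> [x|] [y|] //=; exact: black_sym. Qed.

Lemma contract_black_irr : irreflexive contract_black.
Proof. by move=> [x|] //=; exact: black_irr. Qed.

Lemma contract_red_sym : symmetric contract_red.
Proof. by move=> [x|] [y|] //=; exact: red_sym. Qed.

Lemma contract_red_irr : irreflexive contract_red.
Proof. by move=> [x|] //=; exact: red_irr. Qed.

Lemma contract_disj (a b : contract_vertex) :
  ~~ (contract_black a b && contract_red a b).
Proof.
case: a b => [x|] [y|] //=; first exact: black_red_disj.
  by rewrite /new_red; case: (new_black _).
by rewrite /new_red; case: (new_black _).
Qed.

Definition contract : trigraph :=
  Trigraph contract_black_sym contract_black_irr
    contract_red_sym contract_red_irr contract_disj.
End Contract.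

Definition red_degree_le (d : nat) (T : trigraph) : Prop :=
  forall x : T, #|[set y | red x y]| <= d.

Inductive contraction_seq (d : nat) : trigraph -> trigraph -> Prop :=
| ContractionNil (T : trigraph) :
    red_degree_le d T -> contraction_seq d T T
| ContractionCons (T T' : trigraph) (u v : T) :
    red_degree_le d T -> u != v -> contraction_seq d (contract u v) T' ->
    contraction_seq d T T'.

(* The bound [#|T| <= 1], rather than an equality, gives the graph without
   vertices, which has no contraction sequence to a one-vertex graph,
   twin-width 0. *)
Definition has_contraction_seq (G : graph) (d : nat) : Prop :=
  exists T : trigraph, #|T| <= 1 /\ contraction_seq d (trigraph_of_graph G) T.

Lemma card_contract (T : trigraph) (u v : T) :
  u != v -> #|contract u v| < #|T|.
Proof.
move=> uv; rewrite /= card_option card_sig.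
have -> : #|[pred x | (x != u) && (x != v)]| = #|~: [set u; v]|.
  by apply: eq_card => x; rewrite !inE negb_or.
by rewrite -(cardsC [set u; v]) cards2 uv.
Qed.

Lemma contraction_seq_exists (d : nat) (T : trigraph) :
  #|T| <= d -> exists T' : trigraph, #|T'| <= 1 /\ contraction_seq d T T'.
Proof.
have [n] := ubnP #|T|; elim: n T => // n IHn T; rewrite ltnS => leTn leTd.
have redT : red_degree_le d T by move=> x; apply: leq_trans (max_card _) leTd.
have [le1|] := leqP #|T| 1; first by exists T; split=> //; exact: ContractionNil.
move=> /card_gt1P[u [v [_ _ uv]]]; have ltc := card_contract uv.
have [||T' [le1 seqT']] := IHn (contract u v).
- exact: leq_trans ltc leTn.
- exact: leq_trans (ltnW ltc) leTd.
by exists T'; split=> //; exact: ContractionCons seqT'.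
Qed.

Lemma twin_width_exists (G : graph) : exists d, has_contraction_seq G d.
Proof. by exists #|G|; exact: contraction_seq_exists. Qed.

Definition twin_width (G : graph) : nat := least (twin_width_exists G).

Definition low_twin_width_covers (C : graph_class) : Prop :=
  forall p : nat, 0 < p ->
  exists Cp np : nat, forall G : graph, C G ->
  exists F : {set {set G}},
    [/\ #|F| <= np,
        forall X : {set G}, #|X| <= p -> exists2 B, B \in F & X \subset B
      & forall B : {set G}, B \in F -> twin_width (induced B) <= Cp].

(** * Subdivisions and topological minors *)

(* Each edge occurs once, oriented along the enumeration of the vertices. *)
Definition edge (G : graph) : finType :=
  {e : G * G | adj e.1 e.2 && (enum_rank e.1 < enum_rank e.2)}.

Section Subdivision.
Variables (G : graph) (s : edge G -> nat).

Definition subdiv_vertex : finType := (G + {e : edge G & 'I_(s e)})%type.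

(* The vertex at position [k] on the path replacing [e]; this path has
   positions [0], ..., [(s e).+1]. *)
Definition subdiv_at (e : edge G) (k : nat) : subdiv_vertex :=
  if k is j.+1 then
    if insub j is Some i then inr (existT (fun e => 'I_(s e)) e i)
    else inl (val e).2
  else inl (val e).1.

Definition subdiv_adj : rel subdiv_vertex := fun a b =>
  [exists e : edge G, exists k : 'I_(s e).+1,
     (a == subdiv_at e k) && (b == subdiv_at e k.+1)
  || (b == subdiv_at e k) && (a == subdiv_at e k.+1)].

Lemma subdiv_adj_sym : symmetric subdiv_adj.
Proof.
by move=> a b; apply: eq_existsb => e; apply: eq_existsb => k; rewrite orbC.
Qed.

Lemma subdiv_at_neq (e : edge G) (k : nat) :
  k <= s e -> subdiv_at e k != subdiv_at e k.+1.
Proof.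
case: k => [|j] /= lej.
  case: insubP => // _; apply/eqP => -[] eq12.
  by have /andP[+ _] := valP e; rewrite eq12 adj_irr.
rewrite insubT; case: insubP => // i _ /= valij; apply/eqP => -[].
by move=> /eqP; rewrite eq_Tagged /= => /eqP/(congr1 val)/= /eqP;
  rewrite valij ltn_eqF.
Qed.

Lemma subdiv_adj_irr : irreflexive subdiv_adj.
Proof.
move=> a; apply/existsP => -[e /existsP[k]]; rewrite orbb => /andP[/eqP-> ].
by apply/negP/subdiv_at_neq; rewrite -ltnS.
Qed.

Definition subdivision : graph := Graph subdiv_adj_sym subdiv_adj_irr.
End Subdivision.

Definition TM (r : nat) (G : graph) : graph_class := fun H =>
  exists s : edge H -> nat,
    (forall e, s e <= r) /\ subgraph (subdivision s) G.

Lemma TM_bounded (r : nat) (G : graph) :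
  exists n, forall H, TM r G H -> omega H <= n.
Proof.
exists #|G| => H [s [_ [f [inj_f _]]]].
have leHG : #|H| <= #|G|.
  by apply: (@leq_card _ _ (fun x : H => f (inl x))) => x y /inj_f[].
by apply/bigmax_leqP => A _; apply: leq_trans (max_card _) leHG.
Qed.

(** * Tree-depth *)

(* [connect parent_rel x y]: [y] is [x] or an ancestor of [x]. *)
Definition parent_rel (V : finType) (par : V -> option V) : rel V :=
  fun x y => par x == Some y.

Record rooted_forest := RootedForest {
  node :> finType;
  parent : node -> option node;
  parent_acyclic : forall x y,
    parent x = Some y -> ~~ connect (parent_rel parent) y x }.
Arguments parent {r} x.

Section Forest.
Variable Y : rooted_forest.

Definition ancestor_or_self (y x : Y) : bool :=
  connect (parent_rel (@parent Y)) x y.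

Definition leaf (x : Y) : bool := [forall y : Y, parent y != Some x].

(* The set counted is the path from [x] to the root of its tree. *)
Definition height : nat :=
  \max_(x : Y | leaf x) #|[set y | ancestor_or_self y x]|.

Definition closure_adj : rel Y := fun x y =>
  (x != y) && (ancestor_or_self x y || ancestor_or_self y x).

Lemma closure_adj_sym : symmetric closure_adj.
Proof. by move=> x y; rewrite /closure_adj eq_sym orbC. Qed.

Lemma closure_adj_irr : irreflexive closure_adj.
Proof. by move=> x; rewrite /closure_adj eqxx. Qed.

Definition closure_graph : graph := Graph closure_adj_sym closure_adj_irr.
End Forest.

Definition has_forest_of_height (G : graph) (h : nat) : Prop :=
  exists Y : rooted_forest, height Y = h /\ subgraph G (closure_graph Y).

Section PathForest.
Variable n : nat.

Definition path_parent (i : 'I_n) : option 'I_n :=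
  if val i is j.+1 then insub j else None.

Lemma path_parentP (i j : 'I_n) :
  reflect (val i = j.+1) (parent_rel path_parent i j).
Proof.
rewrite /parent_rel /path_parent; case: i => -[|k] /= lek; apply: (iffP eqP) => //.
  by case: insubP => // l _ <- [->].
by move=> [ekj]; rewrite ekj valK.
Qed.

Lemma path_connect (i j : 'I_n) :
  connect (parent_rel path_parent) i j = (j <= i).
Proof.
apply/idP/idP.
  case/connectP=> p + ->; elim: p i => //= k p IHp i /andP[/path_parentP ik].
  by move=> /IHp /leq_trans -> //; rewrite [val i]ik.
case: i => m; elim: m => [|m IHm] ltm /= leji.
  rewrite (_ : j = Ordinal ltm) ?connect0 //; apply/val_inj/eqP.
  by rewrite -leqn0.
have [jm|] := eqVneq (val j) m.+1.
  by rewrite (_ : j = Ordinal ltm) ?connect0 //; exact: val_inj.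
move=> jm; apply: connect_trans (IHm (ltnW ltm) _).
  exact/connect1/path_parentP.
by rewrite -ltnS ltn_neqAle jm.
Qed.

Lemma path_acyclic (i j : 'I_n) :
  path_parent i = Some j -> ~~ connect (parent_rel path_parent) j i.
Proof.
by move=> /eqP/path_parentP eij; rewrite path_connect eij ltnn.
Qed.

Definition path_forest : rooted_forest := RootedForest path_acyclic.
End PathForest.

Lemma path_forest_subgraph (G : graph) :
  subgraph G (closure_graph (path_forest #|G|)).
Proof.
exists (fun x : G => (enum_rank x : path_forest #|G|)).
split=> [|x y xy]; first exact: enum_rank_inj.
rewrite /= /closure_adj /ancestor_or_self !path_connect leq_total andbT.
rewrite (inj_eq enum_rank_inj); apply: contraTneq xy => ->.
by rewrite adj_irr.
Qed.

Lemma treedepth_exists (G : graph) : exists h, has_forest_of_height G h.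
Proof. by eexists; eexists; split; last exact: path_forest_subgraph. Qed.

Definition treedepth (G : graph) : nat := least (treedepth_exists G).

Lemma treedepth_le_card (G : graph) : treedepth G <= #|G|.
Proof.
have [_ min_td] := leastP (treedepth_exists G).
apply: (leq_trans (min_td (height (path_forest #|G|)) _)).
  by exists (path_forest #|G|); split=> //; exact: path_forest_subgraph.
by apply/bigmax_leqP => x _; rewrite (leq_trans (max_card _)) // card_ord.
Qed.

(** * The numbers [chi p] and weak boundedness *)

Definition has_td_coloring (p : nat) (G : graph) (k : nat) : Prop :=
  exists c : G -> 'I_k, forall I : {set 'I_k},
    #|I| <= p -> treedepth (induced [set x | c x \in I]) <= #|I|.

Lemma chi_exists (p : nat) (G : graph) : exists k, has_td_coloring p G k.
Proof.
exists #|G|, enum_rank => I _; apply: leq_trans (treedepth_le_card _) _.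
rewrite /= card_sig.
have <- := card_imset [set x | enum_rank x \in I] (@enum_rank_inj G).
by apply/subset_leq_card/subsetP => _ /imsetP[x + ->]; rewrite inE.
Qed.

Definition chi (p : nat) (G : graph) : nat := least (chi_exists p G).

Definition weakly_chi_bounded (p : nat) (C : graph_class) : Prop :=
  exists g : nat -> nat, forall G : graph, C G ->
    chi p G <= g (class_omega (TM_bounded p.-1 G)).

(* Main.v *)
Require Import Defs.
From mathcomp Require Import all_boot.
From mathcomp Require Import boolp zify.

(* Refining a low twin-width cover by a product colouring, in which the colour
   of a vertex records the members of the cover that contain it, reduces the
   claim to graphs of twin-width at most [d]: the vertices of at most [p] product
   colours all lie in one member of the cover.

   For [p = 1], undo the contractions and colour the parts with [d + 2] colours.
   A part with a black edge passes its colour on when it is split; one without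
   black edges has at most [d] neighbours, so that one of its halves can be
   recoloured. A monochromatic clique then lies in a single part, or in a part
   with a black edge, hence is not maximal; so each colour class has a smaller
   clique number, and induction applies.

   For [p > 1], a large biclique contains a 1-subdivision of a large complete
   graph, so the graph has no [K_(t,t)]. Order the vertices by the time, undoing
   the contractions, at which their part gets fewer than [t] vertices (Dreier,
   Gajarsky, Jiang, Ossona de Mendez, Raymond). Just before a vertex is born,
   every later vertex lies in a part with at least [t] vertices; such parts are
   joined by red edges only, and black edges lead from such a part to fewer than
   [t] vertices. This bounds strong, hence weak, reachability within any fixed
   distance. By Zhu's argument a greedy colouring that separates each vertex from
   those weakly reachable within distance [2 ^ p] is a tree-depth colouring. *)

Set Implicit Arguments.
Unset Strict Implicit.
Unset Printing Implicit Defensive.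

(** * Subgraphs and counting *)

Lemma subgraph_trans (G1 G2 G3 : graph) :
  subgraph G1 G2 -> subgraph G2 G3 -> subgraph G1 G3.
Proof.
move=> [f [inj_f adj_f]] [g [inj_g adj_g]].
by exists (g \o f); split; [exact: inj_comp | move=> x y /adj_f/adj_g].
Qed.

Lemma induced_subgraph (G : graph) (A : {set G}) : subgraph (induced A) G.
Proof. by exists val; split=> // x y; exact: val_inj. Qed.

Lemma treedepth_subgraph (H G : graph) :
  subgraph H G -> treedepth H <= treedepth G.
Proof.
move=> HG; have [[Y [hY GY]] _] := leastP (treedepth_exists G).
have [_] := leastP (treedepth_exists H); apply.
by exists Y; split=> //; exact: subgraph_trans GY.
Qed.

Lemma card_bigcup_leq (I T : finType) (A : {set I}) (F : I -> {set T}) m :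
  (forall i, i \in A -> #|F i| <= m) -> #|\bigcup_(i in A) F i| <= #|A| * m.
Proof.
move=> leFm; rewrite -sum_nat_const.
apply: (@leq_trans (\sum_(i in A) #|F i|)); last exact: leq_sum.
elim/big_rec2: _ => [|i n B _ leBn]; first by rewrite cards0.
by apply: leq_trans (leq_card_setU _ _) _; rewrite leq_add2l.
Qed.

(** * The elimination forest of a vertex ordering *)

Section TreedepthOfOrder.
Variables (G : graph) (L : G -> nat).
Hypothesis L_inj : injective L.

Definition above (m : nat) : rel G :=
  [rel a b | [&& adj a b, m <= L a & m <= L b]].

(* Weak reachability of [y] from [x], by a path of any length. *)
Definition dominates (y x : G) : bool := connect (above (L y)) x y.

Lemma connect_above_sym m : connect_sym (above m).
Proof.
apply: sym_connect_sym => a b; rewrite /above /=.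
by rewrite adj_sym; congr (_ && _); rewrite andbC.
Qed.

Lemma connect_above_le m n a b :
  m <= n -> connect (above n) a b -> connect (above m) a b.
Proof.
move=> le_mn; apply: connect_sub => x y /and3P[xy nx ny].
by apply: connect1; rewrite /above /= xy !(leq_trans le_mn).
Qed.

Lemma dominates_leq y x : dominates y x -> L y <= L x.
Proof.
case/connectP=> [[|a p]] /=; first by move=> _ ->.
by case/andP=> /and3P[].
Qed.

Lemma dominates_trans y x z :
  dominates y x -> dominates z y -> dominates z x.
Proof.
move=> yx zy; apply: (connect_trans _ zy).
exact: connect_above_le (dominates_leq zy) yx.
Qed.

(** Both paths from [x] stay above [L y]; going back along one and out along the other leads from
    [z] to [y]. Hence the dominators of a vertex form a chain, as the ancestors in a forest must. *)
Lemma dominates_chain x y z :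
  dominates y x -> dominates z x -> L y <= L z -> dominates y z.
Proof.
move=> yx zx le_yz; apply: connect_trans yx.
by rewrite connect_above_sym; exact: connect_above_le zx.
Qed.

Definition order_parent (x : G) : option G :=
  if [pick y | (y != x) && dominates y x] is Some y0
  then Some [arg max_(y > y0 | (y != x) && dominates y x) L y] else None.

Lemma order_parentP x y :
  order_parent x = Some y ->
  [/\ y != x, dominates y x &
      forall z, z != x -> dominates z x -> L z <= L y].
Proof.
rewrite /order_parent; case: pickP => // y0 y0P [<-].
case: arg_maxnP => // i /andP[ix idom] imax; split=> // z zx zdom.
by apply: imax; rewrite zx.
Qed.

Lemma order_parent_lt x y : order_parent x = Some y -> L y < L x.
Proof.
case/order_parentP=> yx ydom _; rewrite ltn_neqAle dominates_leq // andbT.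
by apply: contra_neq yx => /L_inj.
Qed.

Lemma order_acyclic x y :
  order_parent x = Some y -> ~~ connect (parent_rel order_parent) y x.
Proof.
move=> /order_parent_lt ltyx; apply/negP => /connectP[p + xE].
suff: forall p a, path (parent_rel order_parent) a p -> L (last a p) <= L a.
  by move=> H /H; rewrite -xE leqNgt ltyx.
elim=> //= b q IHq a /andP[/eqP/order_parent_lt ltba /IHq].
by move/leq_trans; apply; exact: ltnW.
Qed.

Definition order_forest : rooted_forest := RootedForest order_acyclic.

(** For the converse of transitivity: a proper dominator of [x] is no later than the parent of [x],
    so it dominates that parent by [dominates_chain]. *)
Lemma order_ancestor (y x : G) :
  ancestor_or_self (y : order_forest) x = dominates y x.
Proof.
apply/idP/idP.
  case/connectP=> p + ->; elim: p x => [|a p IHp] x /=.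
    by move=> _; exact: connect0.
  case/andP=> /eqP/order_parentP[_ ax _] /IHp; exact: dominates_trans.
have [n] := ubnP (L x); elim: n x => // n IHn x; rewrite ltnS => lexn yx.
have [-> |nyx] := eqVneq y x; first exact: connect0.
case par_x: (order_parent x) => [z|]; last first.
  move: par_x; rewrite /order_parent; case: pickP => // /(_ y).
  by rewrite nyx yx.
have [nzx zx zmax] := order_parentP par_x.
apply: (@connect_trans _ _ z); first by apply: connect1; apply/eqP.
apply: IHn; first exact: leq_trans (order_parent_lt par_x) lexn.
exact: dominates_chain yx zx (zmax _ nyx yx).
Qed.

(** The earlier end of an edge dominates the later one, so the closure of the forest contains [G].
    Vertices on a root path are comparable for domination, hence differ in colour. *)
Lemma treedepth_order (K : finType) (c : G -> K) (I : {set K}) :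
  (forall x, c x \in I) ->
  (forall x y, y != x -> dominates y x -> c y != c x) ->
  treedepth G <= #|I|.
Proof.
move=> cI c_neq; have [_ min_td] := leastP (treedepth_exists G).
apply: (leq_trans (min_td (height order_forest) _)).
  exists order_forest; split=> //; exists id; split=> // x y xy /=.
  rewrite /closure_adj; apply/andP; split.
    by apply: contraTneq xy => ->; rewrite adj_irr.
  rewrite !order_ancestor /dominates.
  case: (leqP (L x) (L y)) => leL; [apply/orP; left | apply/orP; right].
    by apply: connect1; rewrite /above /= adj_sym xy leqnn leL.
  by apply: connect1; rewrite /above /= xy leqnn ltnW.
apply/bigmax_leqP => x _.
rewrite (_ : [set y | _] = [set y : G | dominates y x]); last first.
  by apply/setP => y; rewrite !inE order_ancestor.
have c_inj : {in [set y | dominates y x] &, injective c}.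
  move=> y z; rewrite !inE => yx zx cyz; apply/eqP; apply: contraT => nyz.
  case: (leqP (L y) (L z)) => leL.
    by have := c_neq _ _ nyz (dominates_chain yx zx leL); rewrite cyz eqxx.
  rewrite eq_sym in nyz.
  by have := c_neq _ _ nyz (dominates_chain zx yx (ltnW leL)); rewrite cyz eqxx.
rewrite -(card_in_imset c_inj); apply/subset_leq_card/subsetP => _ /imsetP[y _ ->].
exact: cI.
Qed.

End TreedepthOfOrder.

(** * Partitions of a graph along a contraction sequence *)

(* The fibres of [f] are the parts; empty parts are allowed, so that [f] can be
   restricted to an induced subgraph. *)
Definition represents (G : graph) (T : trigraph) (f : G -> T) : Prop :=
  (forall a b, black (f a) (f b) -> adj a b) /\
  (forall a b, adj a b ->
     [|| f a == f b, black (f a) (f b) | red (f a) (f b)]).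

Definition contract_proj (T : trigraph) (u v x : T) : contract u v := insub x.

Lemma contract_projP (T : trigraph) (u v x : T) :
  (exists y, [/\ contract_proj u v x = Some y, x = val y, x != u & x != v])
  \/ (contract_proj u v x = None /\ (x = u \/ x = v)).
Proof.
rewrite /contract_proj; case: insubP => [y /andP[xu xv] xE|].
  by left; exists y.
by rewrite negb_and !negbK => /orP[] /eqP ->; right; split=> //; [left|right].
Qed.

Lemma contract_proj_new (T : trigraph) (u v : T) :
  contract_proj u v u = None /\ contract_proj u v v = None.
Proof. by rewrite /contract_proj !insubF ?eqxx ?andbF. Qed.

Lemma contract_proj_eq (T : trigraph) (u v x y : T) :
  contract_proj u v x = contract_proj u v y ->
  x = y \/ ((x = u \/ x = v) /\ (y = u \/ y = v)).
Proof.
case: (contract_projP u v x) => [[x' [-> -> _ _]]|[-> xE]];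
case: (contract_projP u v y) => [[y' [-> -> _ _]]|[-> yE]] //.
  by case=> ->; left.
by right.
Qed.

Lemma represents_contract (G : graph) (T : trigraph) (u v : T) (f : G -> T) :
  represents f -> represents (contract_proj u v \o f).
Proof.
move=> [blackf adjf]; split=> a b /=.
  case: (contract_projP u v (f a)) => [[x [-> xE _ _]]|[-> xE]];
  case: (contract_projP u v (f b)) => [[y [-> yE _ _]]|[-> yE]] //=.
  - by rewrite -xE -yE; exact: blackf.
  - rewrite -xE /new_black => /andP[ub vb]; rewrite adj_sym; apply: blackf.
    by case: yE => ->.
  - rewrite -yE /new_black => /andP[ub vb]; apply: blackf.
    by case: xE => ->.
move=> /adjf.
case: (contract_projP u v (f a)) => [[x [-> xE xu xv]]|[-> xE]];
case: (contract_projP u v (f b)) => [[y [-> yE yu yv]]|[-> yE]] //=.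
- by rewrite xE yE => /or3P[/eqP/val_inj->|->|->]; rewrite ?eqxx ?orbT.
- rewrite -xE (black_sym (f a)) (red_sym (f a)) /new_red => adjab.
  case: (new_black _ _ _) => //=.
  by case: yE adjab => yE; rewrite yE ?(negPf xu) ?(negPf xv) /=
    => /orP[] ->; rewrite ?orbT.
- rewrite -yE eq_sym /new_red => adjab.
  case: (new_black _ _ _) => //=.
  by case: xE adjab => xE; rewrite xE ?(negPf yu) ?(negPf yv) /=
    => /orP[] ->; rewrite ?orbT.
Qed.

Lemma contraction_seq_red (d : nat) (T T' : trigraph) :
  contraction_seq d T T' -> red_degree_le d T.
Proof. by case. Qed.

Lemma contraction_seq_leq (d d' : nat) (T T' : trigraph) :
  d <= d' -> contraction_seq d T T' -> contraction_seq d' T T'.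
Proof.
move=> ledd'; elim=> [T0 red0|T0 T1 u v red0 uv _ IH].
  by apply: ContractionNil => x; exact: leq_trans (red0 x) ledd'.
by apply: ContractionCons IH => // x; exact: leq_trans (red0 x) ledd'.
Qed.

(** * The chromatic number of graphs of bounded twin-width *)

(** [S] stays fixed along the sequence; in [chromatic_bound] it is a colour class of the previous
    rounds. *)
Lemma coarse_coloring (d : nat) (T T' : trigraph) :
  contraction_seq d T T' -> #|T'| <= 1 ->
  forall (G : graph) (f : G -> T) (S : {set G}), represents f ->
  exists col : T -> 'I_d.+2, forall K : {set G},
    clique K -> K \subset S ->
    {in K &, forall a b, col (f a) = col (f b)} ->
    {in K &, forall a b, f a = f b} \/
    exists2 b, b \in S & forall a, a \in K -> adj a b.
Proof.
elim=> [{}T _|{}T {}T' u v _ uv seqT' IH] card1 G f S repf.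
  exists (fun=> ord0) => K _ _ _; left=> a b _ _.
  exact: (fintype_le1P card1).
have [col colP] := IH card1 _ _ S (represents_contract u v repf).
have [pu pv] := contract_proj_new u v.
(* Only black edges to parts that meet [S] count, since the extending vertex must lie in [S]. *)
have [[b bS fb]|inactive] := pselect
  (exists2 b, b \in S & black (None : contract u v) (contract_proj u v (f b))).
  exists (col \o contract_proj u v) => K cK KS monoK.
  have [fiberK|] := colP K cK KS monoK; last by right.
  have [[a aK faN]|noN] := pselect (exists2 a, a \in K & f a = u \/ f a = v).
    right; exists b => // a' a'K; apply: (represents_contract u v repf).1.
    have /= -> := fiberK _ _ a'K aK.
    by have -> : contract_proj u v (f a) = None by case: faN => ->.
  left=> a a' aK a'K; have := fiberK a a' aK a'K.
  by case/contract_proj_eq => // -[fa _]; case: noN; exists a.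
(* [u] keeps the colour of the merged part; [v] gets a colour [g] that avoids it and those of the at
   most [d] red neighbours. *)
pose bad := col None |: col @: [set y | red (None : contract u v) y].
have [g gbad] : exists g, g \notin bad.
  apply/existsP; rewrite -negb_forall; apply/negP => /forallP allbad.
  have : #|bad| <= d.+1.
    rewrite cardsU1; apply: (@leq_add _ _ 1); first exact: leq_b1.
    by rewrite (leq_trans (leq_imset_card _ _)) // (contraction_seq_red seqT').
  have -> : bad = setT by apply/setP => i; rewrite in_setT allbad.
  by rewrite cardsT card_ord ltnn.
move: gbad; rewrite !inE negb_or => /andP[gN gred].
exists (fun x => if x == v then g else col (contract_proj u v x)) => K cK KS monoK.
(* A clique meeting [v] stays in [v]: [u] has another colour, and so has every red neighbour of the
   merged part. *)
have [[a aK fav]|noV] := pselect (exists2 a, a \in K & f a = v).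
  left; suff H b : b \in K -> f b = v by move=> b b' /H -> /H ->.
  move=> bK; apply/eqP; apply: contraT => nfb; have := monoK a b aK bK.
  rewrite fav eqxx (negPf nfb).
  case: (contract_projP u v (f b)) => [[y [fbE yE yu yv]]|[-> _] gE]; last first.
    by rewrite gE eqxx in gN.
  rewrite fbE => gE; case/negP: gred; rewrite gE; apply/imsetP.
  exists (Some y) => //; rewrite inE.
  have ab : adj a b.
    have /forall_inP/(_ a aK)/forall_inP/(_ b bK)/implyP := cK; apply.
    by apply: contra nfb => /eqP<-; rewrite fav.
  have := (represents_contract u v repf).2 a b ab.
  rewrite /= fav pv fbE => /or3P[//| |//] bl.
  by case: inactive; exists b; [exact: subsetP bK | rewrite fbE].
have nfv a : a \in K -> (f a == v) = false.
  by move=> aK; apply/eqP => fa; case: noV; exists a.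
have [|fiberK|] := colP K cK KS; last by right.
  by move=> a b aK bK /=; have := monoK a b aK bK; rewrite !nfv.
left=> a b aK bK; have := fiberK a b aK bK; have := nfv a aK; have := nfv b bK.
move=> /eqP fb /eqP fa /contract_proj_eq[] // -[[fau|//] [fbu|//]].
by rewrite fau fbu.
Qed.

(** In one class of [coarse_coloring] a clique is a single vertex, as [f] is injective, or extends
    within [S]; so the clique bound drops by one while the number of colours is multiplied by
    [d + 2]. *)
Lemma chromatic_bound (d k : nat) (G : graph) (T T' : trigraph) (f : G -> T)
    (S : {set G}) :
  contraction_seq d T T' -> #|T'| <= 1 -> represents f -> injective f ->
  (forall K : {set G}, clique K -> K \subset S -> #|K| <= k.+1) ->
  exists c : G -> 'I_(d.+2 ^ k), {in S &, forall x y, adj x y -> c x != c y}.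
Proof.
move=> seqT card1 repf inj_f; elim: k S => [|k IHk] S omegaS.
  exists (fun=> ord0) => x y xS yS xy; exfalso.
  have nxy : x != y by apply: contraTneq xy => ->; rewrite adj_irr.
  have := omegaS [set x; y]; rewrite cards2 nxy; case/(_ _ _)/negP => //; last first.
    by apply/subsetP => z /set2P[] ->.
  apply/forall_inP => a /set2P aE; apply/forall_inP => b /set2P bE.
  by case: aE bE => -> [] ->; rewrite ?eqxx // ?xy ?implybT // adj_sym xy implybT.
have [col colP] := coarse_coloring seqT card1 S repf.
have /choice[c cP] : forall i : 'I_d.+2, exists c : G -> 'I_(d.+2 ^ k),
    {in [set x in S | col (f x) == i] &, forall x y, adj x y -> c x != c y}.
  move=> i; apply: IHk => K cK /subsetP KSi.
  have KS : K \subset S by apply/subsetP => x /KSi; rewrite inE => /andP[].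
  have [a b aK bK|fib|[b bS bP]] := colP K cK KS.
  - have := KSi a aK; have := KSi b bK.
    by rewrite !inE => /andP[_ /eqP->] /andP[_ /eqP->].
  - have [->|[a aK]] := set_0Vmem K; first by rewrite cards0.
    rewrite (@leq_trans 1) // -(cards1 a); apply/subset_leq_card/subsetP => b bK.
    by rewrite inE; apply/eqP/inj_f/fib.
  have bK : b \notin K by apply/negP => /bP; rewrite adj_irr.
  have := omegaS (b |: K); rewrite cardsU1 bK; apply; last first.
    by apply/subsetP => x /setU1P[->|/(subsetP KS)].
  apply/forall_inP => x /setU1P xE; apply/forall_inP => y /setU1P yE.
  apply/implyP => nxy; case: xE yE nxy => [->|xK] [->|yK] nxy.
  - by rewrite eqxx in nxy.
  - by rewrite adj_sym bP.
  - exact: bP.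
  by have /forall_inP/(_ x xK)/forall_inP/(_ y yK)/implyP := cK; apply.
have cardE : #|{: 'I_d.+2 * 'I_(d.+2 ^ k)}| = d.+2 ^ k.+1.
  by rewrite card_prod !card_ord expnS.
exists (fun x => cast_ord cardE (enum_rank (col (f x), c (col (f x)) x))).
move=> x y xS yS xy; rewrite (inj_eq (@cast_ord_inj _ _ _)) (inj_eq enum_rank_inj).
rewrite xpair_eqE; case: eqP => //= colE; rewrite -colE.
by apply: cP => //; rewrite inE ?xS ?yS colE eqxx.
Qed.

(** * Strong reachability in biclique-free graphs of bounded twin-width *)

Definition biclique_free (t : nat) (G : graph) : Prop :=
  forall A B : {set G}, t <= #|A| -> t <= #|B| ->
  ~ {in A & B, forall a b, adj a b}.

Section BicliqueFree.
Variables (G : graph) (t d r : nat).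
Hypothesis Gt : biclique_free t G.

(** The inequalities are weak because vertices born together share a value of [tau]; bounds then
    pass to linear refinements by [strongly_sub]. *)
Definition strongly_reaches (tau : G -> nat) (x y : G) : Prop :=
  exists p : seq G, [/\ size p <= r, path adj x (rcons p y),
    all (fun v => tau x <= tau v) p & tau y <= tau x].

Section Fibers.
Variables (T : trigraph) (f : G -> T).
Hypotheses (repf : represents f) (redT : red_degree_le d T).

Definition fiber (w : T) : {set G} := [set a | f a == w].
Definition big (w : T) : bool := t <= #|fiber w|.

Definition red_ball (k : nat) (w : T) : {set T} :=
  iter k (fun S : {set T} => S :|: \bigcup_(z in S) [set y | red z y]) [set w].

Lemma card_red_ball k w : #|red_ball k w| <= d.+1 ^ k.
Proof.
elim: k => [|k IHk] /=; first by rewrite cards1.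
apply: leq_trans (leq_card_setU _ _) _.
rewrite -/(red_ball k w) expnS mulSn leq_add // mulnC.
apply: leq_trans (card_bigcup_leq (fun z _ => redT z)) _.
by rewrite leq_mul2r IHk orbT.
Qed.

Lemma red_ball_le k m w : k <= m -> red_ball k w \subset red_ball m w.
Proof.
move=> /subnK <-; elim: (m - k) => //= i IHi.
exact: subset_trans IHi (subsetUl _ _).
Qed.

Lemma big_not_black a b : big (f a) -> big (f b) -> ~~ black (f a) (f b).
Proof.
move=> biga bigb; apply/negP => ab; apply: (Gt biga bigb) => x y.
by rewrite !inE => /eqP fx /eqP fy; apply: repf.1; rewrite fx fy.
Qed.

(** Each edge stays in a part or follows a red edge, as no black edge joins two big parts. *)
Lemma path_red_ball x p :
  path adj x p -> big (f x) -> all (fun v => big (f v)) p ->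
  f (last x p) \in red_ball (size p) (f x).
Proof.
elim/last_ind: p => [|p y IHp] /=; first by rewrite inE.
rewrite rcons_path all_rcons last_rcons size_rcons /=.
move=> /andP[xp py] bigx /andP[bigy bigp]; have := IHp xp bigx bigp.
have bigl : big (f (last x p)).
  by have := mem_last x p; rewrite inE => /predU1P[->|/(allP bigp)].
rewrite -/(red_ball (size p) (f x)).
have /or3P[/eqP <- inB|bl|redpy inB] := repf.2 _ _ py.
- by rewrite inE inB.
- by have := big_not_black bigl bigy; rewrite bl.
by rewrite inE; apply/orP; right; apply/bigcupP; exists (f (last x p)); rewrite ?inE.
Qed.

Definition small_nbrs (w : T) : {set G} :=
  [set y | black w (f y)] :|:
  \bigcup_(z in [set z | red w z]) (if big z then set0 else fiber z).

(** The far ends of the black edges at [w] form a biclique with the fibre of [w]; each of the at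
    most [d] red neighbours that are small has fewer than [t] vertices. *)
Lemma card_small_nbrs w : big w -> #|small_nbrs w| <= t + d * t.
Proof.
move=> bigw; apply: leq_trans (leq_card_setU _ _) _; apply: leq_add.
  rewrite leqNgt; apply/negP => /ltnW ltt; apply: (Gt bigw ltt) => a b.
  by rewrite !inE => /eqP fa wb; apply: repf.1; rewrite fa.
apply: (@leq_trans (#|[set z | red w z]| * t)); last by rewrite leq_mul2r redT orbT.
apply: card_bigcup_leq => z _; case: ifPn; first by rewrite cards0.
by rewrite /big -ltnNge => /ltnW.
Qed.

Lemma adj_small_nbrs a y :
  adj a y -> big (f a) -> ~~ big (f y) -> y \in small_nbrs (f a).
Proof.
move=> ay biga smally; rewrite inE; apply/orP.
have /or3P[/eqP faE|bl|re] := repf.2 _ _ ay.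
- by rewrite -faE biga in smally.
- by left; rewrite inE.
right; apply/bigcupP; exists (f y); rewrite ?inE //.
by rewrite (negPf smally) inE.
Qed.

Lemma big_path_small x p y :
  size p <= r -> path adj x (rcons p y) -> all (fun v => big (f v)) (x :: p) ->
  ~~ big (f y) ->
  y \in \bigcup_(w in red_ball r (f x) :&: [set w | big w]) small_nbrs w.
Proof.
move=> lepr; rewrite rcons_path => /andP[xp py] bigxp smally.
have bigl : big (f (last x p)) by exact: (allP bigxp) (mem_last x p).
case/andP: bigxp => bigx bigp.
apply/bigcupP; exists (f (last x p)); last exact: adj_small_nbrs.
rewrite !inE bigl andbT; apply: (subsetP (red_ball_le _ lepr)).
exact: path_red_ball.
Qed.

Lemma card_big_path_small w :
  #|\bigcup_(z in red_ball r w :&: [set z | big z]) small_nbrs z|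
    <= d.+1 ^ r * (t + d * t).
Proof.
apply: (leq_trans (card_bigcup_leq (m := t + d * t) _)).
  by move=> z; rewrite !inE => /andP[_]; exact: card_small_nbrs.
rewrite leq_mul2r (leq_trans _ (card_red_ball r w)) ?orbT //.
exact/subset_leq_card/subsetIl.
Qed.

End Fibers.

(** [t + t] is for the vertices born in the two halves of a split part, the last term for the ends
    of paths through big parts. *)
Definition reach_bound : nat := t + t + d.+1 ^ r * (t + d * t).

(* [tau] is the time of birth; the vertices of big parts, not yet born, all have
   the value [N], which exceeds that of every other vertex. *)
Lemma birth_order (T T' : trigraph) :
  contraction_seq d T T' -> #|T'| <= 1 ->
  forall f : G -> T, represents f ->
  exists (N : nat) (tau : G -> nat),
    [/\ forall a, big f (f a) -> tau a = N,
        forall a, ~~ big f (f a) -> tau a < N &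
        forall x, ~~ big f (f x) ->
          #|[set y | `[< strongly_reaches tau x y >]]| <= reach_bound].
Proof.
elim=> [{}T _|{}T {}T' u v _ uv seqT' IH] card1 f repf.
  (* If the only part is small, then [G] has fewer than [t] vertices. *)
  exists 1, (fun a => big f (f a) : nat); split=> [a ->|a /negPf-> |x] //.
  rewrite /big -ltnNge => ltt; apply: leq_trans (max_card _) _.
  have -> : #|G| = #|fiber f (f x)|.
    by apply: eq_card => y; rewrite !inE (fintype_le1P card1 (f y) (f x)) eqxx.
  by rewrite (leq_trans (ltnW ltt)) // /reach_bound -addnA leq_addr.
have repf' := represents_contract u v repf.
have red' := contraction_seq_red seqT'.
set f' := contract_proj u v \o f in repf' *.
have [N [tau [tau_big tau_small tau_reach]]] := IH card1 f' repf'.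
have big_mono a : big f (f a) -> big f' (f' a).
  move=> biga; apply: leq_trans biga _; apply/subset_leq_card/subsetP => b.
  by rewrite !inE /f' /= => /eqP->.
have newborn a : big f' (f' a) -> ~~ big f (f a) ->
    a \in (if big f u then set0 else fiber f u) :|: (if big f v then set0 else fiber f v).
  move=> biga' smalla; rewrite inE.
  have [fau|nfau] := eqVneq (f a) u; first by rewrite -fau (negPf smalla) inE eqxx.
  have [fav|nfav] := eqVneq (f a) v; first by rewrite -fav (negPf smalla) !inE eqxx orbT.
  case/negP: smalla; apply: leq_trans biga' _; apply/subset_leq_card/subsetP => b.
  rewrite !inE /f' /= => /eqP/contract_proj_eq[->//|[_ [faE|faE]]].
    by rewrite faE eqxx in nfau.
  by rewrite faE eqxx in nfav.
have card_newborn w : #|if big f w then set0 else fiber f w| <= t.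
  by case: ifPn; rewrite ?cards0 // /big -ltnNge => /ltnW.
(* Vertices born at this split take the former top value [N]; those still unborn move to [N + 1]. *)
pose tau' a := if big f' (f' a) then (if big f (f a) then N.+1 else N) else tau a.
have tau'_old a : tau' a < N -> ~~ big f' (f' a).
  by rewrite /tau'; case: (big f' _) => //; case: ifP => _; lia.
have tau'_eq a : ~~ big f' (f' a) -> tau' a = tau a by rewrite /tau' => /negPf->.
exists N.+1, tau'; split=> [a biga|a smalla|x smallx].
- by rewrite /tau' (big_mono _ biga) biga.
- rewrite /tau' (negPf smalla); case: ifPn => [_|/tau_small/ltnW] //.
case: (boolP (big f' (f' x))) => bigx'; last first.
  (* [x] was born earlier: values below [N] are unchanged and the others were [N], so the same path
     serves for [tau]. *)
  apply: leq_trans (tau_reach x bigx'); apply/subset_leq_card/subsetP => y.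
  rewrite !inE => /asboolP[p [szp xpy allp leyx]]; apply/asboolP.
  have ltxN := tau_small x bigx'; rewrite tau'_eq // in allp leyx.
  have oldy : ~~ big f' (f' y) by apply: tau'_old; exact: leq_ltn_trans leyx ltxN.
  rewrite tau'_eq // in leyx.
  exists p; split=> //; apply: sub_all allp => w /=; rewrite /tau'.
  by case: ifPn => // bigw _; rewrite (tau_big w bigw) ltnW.
have tauxN : tau' x = N by rewrite /tau' bigx' (negPf smallx).
(* [x] is born now: inner vertices of the path have value at least [N], so their parts were big
   before the split. The end is born now too, in [A], or was born earlier, in [B]. *)
pose B := \bigcup_(w in red_ball r (f' x) :&: [set w | big f' w]) small_nbrs f' w.
pose A := (if big f u then set0 else fiber f u) :|: (if big f v then set0 else fiber f v).
apply: (@leq_trans #|A :|: B|); last first.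
  apply: leq_trans (leq_card_setU _ _) _; apply: leq_add.
    by apply: leq_trans (leq_card_setU _ _) _; apply: leq_add.
  exact: card_big_path_small.
apply/subset_leq_card/subsetP => y; rewrite inE => /asboolP[p [szp xpy allp leyx]].
rewrite tauxN in allp leyx; rewrite inE; apply/orP.
have [bigy'|smally'] := boolP (big f' (f' y)).
  left; apply: newborn => //; apply/negP => bigy.
  by move: leyx; rewrite /tau' bigy' bigy ltnn.
right; apply: big_path_small szp xpy _ smally' => //=; rewrite bigx' /=.
apply: sub_all allp => w; apply: contraLR => smallw.
by rewrite -ltnNge tau'_eq // tau_small.
Qed.

End BicliqueFree.

(** * Weak reachability and tree-depth colourings *)

Section WeakReach.
Variables (G : graph) (L : G -> nat).

(** Here [r] bounds the number of edges; in [strongly_reaches] it bounds that of inner vertices. *)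
Definition weakly_reaches (r : nat) (x y : G) : Prop :=
  exists p : seq G, [/\ size p <= r, path adj x p, last x p = y &
    all (fun v => L y <= L v) (x :: p)].

(** Cut the path at its first vertex [s] after [x] with [L s <= L x]: [s] is strongly reachable from
    [x], and a shorter path remains from [s]. *)
Lemma card_weakly_reaches (r R M : nat) :
  r <= R ->
  (forall x, #|[set y | `[< strongly_reaches R L x y >]]| <= M) ->
  forall x, #|[set y | `[< weakly_reaches r x y >]]| <= M.+1 ^ r.
Proof.
move=> + strongM; elim: r => [|r IHr] lerR x.
  rewrite expn0 -(cards1 x); apply/subset_leq_card/subsetP => y; rewrite !inE.
  by move=> /asboolP[[|a p] [//= _ _ ->]].
pose S := [set y | `[< strongly_reaches R L x y >]].
pose U := \bigcup_(s in S) [set y | `[< weakly_reaches r s y >]].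
have leU : #|U| <= M * M.+1 ^ r.
  apply: leq_trans (card_bigcup_leq (fun s _ => IHr (ltnW lerR) s)) _.
  by rewrite leq_mul2r strongM orbT.
apply: (@leq_trans #|x |: U|); last first.
  rewrite cardsU1 expnS mulSn; apply: leq_add leU.
  by apply: leq_trans (leq_b1 _) _; rewrite expn_gt0.
apply/subset_leq_card/subsetP => y; rewrite inE => /asboolP[p [szp xp yE allp]].
rewrite in_setU1; have [//|nyx /=] := eqVneq y x.
have hasp : has (fun v => L v <= L x) p.
  apply/hasP; exists y; last by case/andP: allp.
  by have := mem_last x p; rewrite yE inE (negPf nyx).
case/split_find: hasp szp xp yE allp => s p1 p2 /= lesx hasNp1.
rewrite size_cat size_rcons cat_path last_cat last_rcons => szp /andP[xp1 sp2] yE.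
rewrite all_cat all_rcons => /and3P[lyx /andP[lys allp1] allp2].
apply/bigcupP; exists s; rewrite inE; apply/asboolP.
  exists p1; split=> //; first by lia.
  apply/allP => v vp1; rewrite ltnW // ltnNge.
  by apply: contra hasNp1 => lev; apply/hasP; exists v.
by exists p2; split=> //=; [lia | rewrite lys].
Qed.

(** Induction on the level: vertices at level [n] take a colour missing among their [R]-neighbours,
    and lower levels keep theirs. *)
Lemma greedy_coloring (R : rel G) (B : nat) :
  (forall x, #|[set y | R x y]| <= B) ->
  exists c : G -> 'I_B.+1, forall x y, R x y -> L y < L x -> c x != c y.
Proof.
move=> degR.
suff [c cP] : exists c : G -> 'I_B.+1,
    forall x y, L x < (\max_x L x).+1 -> R x y -> L y < L x -> c x != c y.
  by exists c => x y; apply: cP; rewrite ltnS; exact: (leq_bigmax x).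
elim: (\max_x L x).+1 => [|n [c cP]]; first by exists (fun=> ord0).
have /choice[g gP] : forall x, exists i : 'I_B.+1, i \notin c @: [set y | R x y].
  move=> x; apply/existsP; rewrite -negb_forall; apply/negP => /forallP allbad.
  have : #|c @: [set y | R x y]| <= B by exact: leq_trans (leq_imset_card _ _) _.
  have -> : c @: [set y | R x y] = setT by apply/setP => i; rewrite in_setT allbad.
  by rewrite cardsT card_ord ltnn.
exists (fun x => if L x == n then g x else c x) => x y ltx xy ltyx.
have /negPf-> : L y != n by lia.
case: (L x =P n) => [_|nxn]; last by apply: cP => //; lia.
by apply: contra (gP x) => /eqP->; apply: imset_f; rewrite inE.
Qed.

Lemma strongly_sub (tau : G -> nat) (R : nat) x y :
  (forall a b, L a <= L b -> tau a <= tau b) ->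
  strongly_reaches R L x y -> strongly_reaches R tau x y.
Proof.
move=> mono [p [szp xp allp leyx]]; exists p; split=> //; last exact: mono.
by apply: sub_all allp => v /mono.
Qed.

Hypothesis L_inj : injective L.
Variables (K : finType) (c : G -> K) (r : nat).
Hypothesis c_neq : forall x y, x != y -> weakly_reaches r x y -> c x != c y.

(** The earliest vertex [m] is weakly reachable from all others, so its colour is not repeated; the
    longer side of [m] has at least half of [2 ^ q.+1] vertices, and induction applies to it. *)
Lemma path_colors (q : nat) (s : seq G) :
  uniq s -> sorted adj s -> 2 ^ q <= size s <= r.+1 ->
  q < #|[set c x | x in s]|.
Proof.
elim: q s => [|q IHq] s uniqs sorteds /andP[lsz usz].
  case: s lsz {uniqs sorteds usz} => // a s _; apply/card_gt0P; exists (c a).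
  by apply: imset_f; rewrite inE eqxx.
have [m ms mmin] : exists2 m, m \in s & forall x, x \in s -> L m <= L x.
  case: s lsz {uniqs sorteds usz} => [|a s _]; first by rewrite leqn0 expn_eq0.
  by have [m ms mmin] := @arg_minnP _ a (mem (a :: s)) L (mem_head a s); exists m.
case/splitPr: ms uniqs sorteds lsz usz mmin => s1 s2.
have tail s' x : sorted adj (m :: s') -> size s' <= r -> x \in s' ->
    (forall z, z \in s' -> L m <= L z) -> m != x -> c m != c x.
  move=> ms' szs' xs' minm nmx; rewrite eq_sym; apply: c_neq; first by rewrite eq_sym.
  case/path.splitP: xs' ms' szs' minm => p1 p2.
  rewrite /= cat_path size_cat size_rcons => /andP[mp1 _] szs' minm.
  exists (rev (m :: p1)); split.
  - by rewrite size_rev /=; lia.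
  - have := rev_path adj m (rcons p1 x); rewrite last_rcons belast_rcons => ->.
    by rewrite (eq_path (e' := adj)) // => a b; rewrite adj_sym.
  - by rewrite rev_cons last_rcons.
  apply/allP => z; rewrite inE mem_rev inE => /or3P[/eqP->|/eqP->|zp1] //.
    by apply: minm; rewrite mem_cat mem_rcons inE eqxx.
  by apply: minm; rewrite mem_cat mem_rcons inE zp1 orbT.
rewrite cat_uniq /= negb_or => /and3P[uniq1 /andP[ms1 _] /andP[ms2 uniq2]].
rewrite size_cat /= => sorteds lsz usz mmin.
have sorted2 : sorted adj (m :: s2).
  by move: sorteds; case: (s1) => //= a s1'; rewrite cat_path /= => /and3P[].
have sorted1 : sorted adj (m :: rev s1).
  have : sorted adj (rcons s1 m).
    by move: sorteds; rewrite -cat_rcons; case: (s1) => //= a s1';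
      rewrite cat_path => /andP[].
  by rewrite -{1}(revK (rcons s1 m)) rev_sorted rev_rcons; congr is_true;
    apply: eq_sorted => a b; rewrite adj_sym.
(* The left side is reversed, so that either side starts next to [m]. *)
suff H s' : {subset s' <= s1 ++ m :: s2} -> uniq s' -> sorted adj (m :: s') ->
    m \notin s' -> 2 ^ q <= size s' -> q.+1 < #|[set c x | x in s1 ++ m :: s2]|.
  have [le1|lt1] := leqP (2 ^ q) (size s1).
    apply: (H (rev s1)); rewrite ?rev_uniq ?mem_rev ?size_rev //.
    by move=> x; rewrite mem_rev mem_cat => ->.
  apply: (H s2) => //; first by move=> x xs2; rewrite mem_cat inE xs2 !orbT.
  move: lsz lt1; rewrite expnS; move: (2 ^ q) (size s1) (size s2) => e n1 n2; lia.
move=> subs uniqs' sorted' ms' lsz'.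
have szs' : size s' <= r.
  have : size s' <= size (s1 ++ s2).
    apply: uniq_leq_size => // x xs'; have := subs x xs'.
    have /negPf nxm : x != m by apply: contraNneq ms' => <-.
    by rewrite !mem_cat inE nxm.
  by rewrite size_cat => /leq_trans; apply; rewrite -ltnS -addnS.
have IH : q < #|[set c x | x in s']|.
  apply: IHq => //; first exact: path_sorted sorted'.
  by rewrite lsz' ltnW.
apply: leq_ltn_trans IH _; apply: proper_card; apply/properP; split.
  by apply/subsetP => _ /imsetP[x xs' ->]; apply: imset_f; exact: subs.
exists (c m); first by apply: imset_f; rewrite mem_cat inE eqxx orbT.
apply/imsetP => -[x xs' cE].
have nmx : m != x by apply: contraNneq ms' => ->.
have := tail s' x sorted' szs' xs' (fun z zs' => mmin z (subs z zs')) nmx.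
by rewrite cE eqxx.
Qed.

(** A simple path from [x] to a dominator has at most [r] edges, giving weak reachability, or starts
    with [2 ^ p] vertices, which show more than [p] colours. *)
Lemma treedepth_color_classes (p : nat) (I : {set K}) :
  2 ^ p <= r.+1 -> #|I| <= p ->
  treedepth (induced [set x | c x \in I]) <= #|I|.
Proof.
move=> lepr leIp; set A := [set x | c x \in I].
apply: (@treedepth_order (induced A) (L \o val) _ K (c \o val)).
- exact: inj_comp L_inj val_inj.
- by move=> x; have := valP x; rewrite inE.
move=> x y nyx /connectP[q0 xq0]; case/shortenP: xq0 => q xq uniqq _ yE {q0}.
have nvxy : val x != val y by rewrite (inj_eq val_inj) eq_sym.
have pathq : path adj (val x) (map val q).
  rewrite path_map; apply: sub_path xq => a b /and3P[] //.
have Lq : all (fun v => L (val y) <= L v) (map val (x :: q)).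
  have xlast : L (val y) <= L (val x).
    case: q xq yE {uniqq pathq} => [_ ->//|a q] /= /andP[/and3P[]] //.
  rewrite /= xlast /= all_map; apply/allP => z zq.
  case/splitPr: zq xq {uniqq pathq yE} => q1 q2; rewrite cat_path /=.
  by move=> /and3P[_ /and3P[]].
have lastq : last (val x) (map val q) = val y by rewrite last_map -yE.
have uniqv : uniq (map val (x :: q)) by rewrite (map_inj_uniq val_inj).
rewrite /= eq_sym; have [ler|ltr] := leqP (size q) r.
  by apply: c_neq => //; exists (map val q); rewrite size_map.
pose s := take (2 ^ p) (map val (x :: q)).
have szs : size s = 2 ^ p by rewrite size_takel //= size_map (leq_trans lepr) ?leqW.
have : p < #|[set c z | z in s]|.
  apply: path_colors; rewrite ?szs ?leqnn //; first exact: take_uniq.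
  exact: take_sorted.
suff : #|[set c z | z in s]| <= #|I| by lia.
apply/subset_leq_card/subsetP => _ /imsetP[z /mem_take/mapP[w _ ->] ->].
by have := valP w; rewrite inE.
Qed.

End WeakReach.

(** * Topological minors *)

Lemma widen_ord_inj (m n : nat) (le_mn : m <= n) : injective (widen_ord le_mn).
Proof. by move=> i j /(congr1 val) /= /val_inj. Qed.

Section CompleteGraph.
Variable n : nat.

Definition complete_adj : rel 'I_n := fun x y => x != y.

Lemma complete_adj_sym : symmetric complete_adj.
Proof. by move=> x y; rewrite /complete_adj eq_sym. Qed.

Lemma complete_adj_irr : irreflexive complete_adj.
Proof. by move=> x; rewrite /complete_adj eqxx. Qed.

Definition complete_graph : graph := Graph complete_adj_sym complete_adj_irr.

Lemma omega_complete : n <= omega complete_graph.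
Proof.
rewrite -{1}[n]card_ord -cardsT.
apply: (@leq_bigmax_cond _ (@clique complete_graph) (fun A => #|A|) setT).
by apply/forall_inP => x _; apply/forall_inP => y _; apply/implyP.
Qed.

End CompleteGraph.

(** Branch vertices go to [A], subdivision vertices to [B] at the rank of their pair of ends; hence
    the square. *)
Lemma biclique_free_of_TM (G : graph) (r n : nat) : 0 < r ->
  (forall H, TM r G H -> omega H <= n) -> biclique_free (n.+2 * n.+2) G.
Proof.
move=> r_gt0 TMn A B leA leB AB.
suff /TMn : TM r G (complete_graph n.+2).
  by rewrite leqNgt (leq_trans _ (omega_complete n.+2)).
have leA' : n.+2 <= #|A| by apply: leq_trans leA; rewrite leq_pmulr.
have leB' : #|{: 'I_n.+2 * 'I_n.+2}| <= #|B| by rewrite card_prod card_ord.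
exists (fun=> 1); split=> //.
pose f (x : subdivision (G := complete_graph n.+2) (fun=> 1)) : G :=
  match x with
  | inl i => enum_val (widen_ord leA' i)
  | inr e => enum_val (widen_ord leB' (enum_rank (val (tag e))))
  end.
have f_inl i : f (inl i) \in A by exact: enum_valP.
have f_inr e : f (inr e) \in B by exact: enum_valP.
have f_neq i e : f (inl i) != f (inr e).
  by apply: contraTneq (AB _ _ (f_inl i) (f_inr e)) => ->; rewrite adj_irr.
exists f; split=> [[i|[e i]] [j|[e' j]] | x y].
- by move/enum_val_inj/widen_ord_inj ->.
- by move/eqP; rewrite (negPf (f_neq _ _)).
- by move/esym/eqP; rewrite (negPf (f_neq _ _)).
- move/enum_val_inj/widen_ord_inj/enum_rank_inj/val_inj => /= ee'.
  by case: _ / ee' j => j; rewrite (ord1 i) (ord1 j).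
case/existsP=> e /existsP[[k ltk]].
suff adj_sub : adj (f (subdiv_at (fun=> 1) e k)) (f (subdiv_at (fun=> 1) e k.+1)).
  by case/orP=> /andP[/eqP-> /eqP->] //; rewrite adj_sym.
case: k ltk => [|[|//]] _ /=.
  by rewrite insubT; exact: AB (f_inl _) (f_inr _).
rewrite insubT; case: insubP => [[]//|_].
by rewrite adj_sym; exact: AB (f_inl _) (f_inr _).
Qed.

(** [G] is in [TM r G] by the subdivision without new vertices. *)
Lemma omega_TM (G : graph) (r n : nat) :
  (forall H, TM r G H -> omega H <= n) -> omega G <= n.
Proof.
apply; exists (fun=> 0); split=> //.
have noI0 (e : {e : edge G & 'I_0}) : False by case: e => e [].
exists (fun x => match x with inl a => a | inr e => False_rect _ (noI0 e) end).
split=> [[a|e] [b|e']|]; try by case: (noI0 e) || case: (noI0 e').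
  by move=> ->.
move=> x y /existsP[e /existsP[[k ltk]]].
case: k ltk => //= _; case: insubP => [[]//|_].
have /andP[adje _] := valP e.
by case/orP => /andP[/eqP-> /eqP->] //; rewrite adj_sym.
Qed.

Lemma TM_subgraph (r : nat) (G G' H : graph) :
  subgraph G G' -> TM r G H -> TM r G' H.
Proof.
by move=> GG' [s [les sG]]; exists s; split=> //; exact: subgraph_trans GG'.
Qed.

(** * Tree-depth colourings *)

Definition td_coloring (p : nat) (G : graph) (K : finType) (c : G -> K) : Prop :=
  forall I : {set K}, #|I| <= p -> treedepth (induced [set x | c x \in I]) <= #|I|.

Lemma td_coloring_inj (p : nat) (G : graph) (K K' : finType) (c : G -> K)
    (h : K -> K') : injective h -> td_coloring p c -> td_coloring p (h \o c).
Proof.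
move=> inj_h tdc I leI.
have leP : #|h @^-1: I| <= #|I|.
  by rewrite -(card_imset _ inj_h); apply/subset_leq_card/subsetP => _
    /imsetP[x + ->]; rewrite inE.
apply: (leq_trans _ leP); rewrite (_ : [set x | _] = [set x | c x \in h @^-1: I]).
  exact: tdc _ (leq_trans leP leI).
by apply/setP => x; rewrite !inE.
Qed.

Lemma chi_leq_card (p : nat) (G : graph) (K : finType) (c : G -> K) :
  td_coloring p c -> chi p G <= #|K|.
Proof.
move=> tdc; have [_] := leastP (chi_exists p G); apply.
exists (enum_rank \o c); exact: td_coloring_inj enum_rank_inj tdc.
Qed.

Lemma proper_td_coloring (G : graph) (K : finType) (c : G -> K) :
  (forall x y, adj x y -> c x != c y) -> td_coloring 1 c.
Proof.
move=> cP I /card_le1_eqP leI.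
have cI (x : induced [set x | c x \in I]) : c (val x) \in I.
  by have := valP x; rewrite inE.
apply: (@treedepth_order (induced _) (fun x => enum_rank x) _ _ (c \o val)).
- by move=> x y /val_inj/enum_rank_inj.
- exact: cI.
move=> x y nyx /connectP[[|z q]] /=; first by move=> _ yx; rewrite yx eqxx in nyx.
case/andP=> /and3P[xz _ _] _ _; have /eqP[] := cP _ _ xz.
exact: leI (cI z) (cI x).
Qed.

(** A sum, so that the colours of both cases, [p = 1] and [p > 1], embed by [widen_ord]. *)
Definition color_bound (p d n : nat) : nat :=
  (d.+2 ^ n) + (reach_bound (n.+2 * n.+2) d (2 ^ p)).+1 ^ (2 ^ p) + 1.

Lemma contraction_td_coloring (p d n : nat) (G : graph) : 0 < p ->
  (forall H, TM p.-1 G H -> omega H <= n) -> twin_width G <= d ->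
  exists c : G -> 'I_(color_bound p d n), td_coloring p c.
Proof.
move=> p_gt0 TMn tww.
have [[T [card1 seqT0]] _] := leastP (twin_width_exists G).
have seqT := contraction_seq_leq tww seqT0.
have repid : represents (id : G -> trigraph_of_graph G).
  by split=> // a b; rewrite /= => ->; rewrite orbT.
move: p_gt0; rewrite leq_eqVlt => /predU1P[p1|p_gt1].
  have omegaG := omega_TM TMn.
  have [|c cP] := chromatic_bound (k := n) (S := setT) seqT card1 repid (@inj_id G).
    move=> K cK _; apply: leqW; apply: leq_trans omegaG.
    exact: (@leq_bigmax_cond _ (@clique G) (fun A => #|A|)).
  have le_col : d.+2 ^ n <= color_bound p d n by rewrite /color_bound -addnA leq_addr.
  exists (widen_ord le_col \o c); apply: td_coloring_inj (@widen_ord_inj _ _ _) _.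
  rewrite -p1; apply: proper_td_coloring => x y; apply: cP; exact: in_setT.
set t := n.+2 * n.+2.
have Gt : biclique_free t G by apply: biclique_free_of_TM TMn; lia.
pose r := 2 ^ p; pose M := reach_bound t d r.
have [N [tau [_ _ tau_reach]]] := birth_order r Gt seqT card1 repid.
(* With all contractions undone the parts are singletons, so every vertex is born. *)
have small (x : G) : ~~ big t (id : G -> trigraph_of_graph G) x.
  rewrite /big -ltnNge (_ : fiber _ _ = [set x]); first by rewrite cards1.
  by apply/setP => y; rewrite !inE.
(* Ties of [tau] are broken by [enum_rank]; division by [#|G|] recovers [tau]. *)
pose L (x : G) : nat := tau x * #|G| + enum_rank x.
have L_div (x : G) : L x %/ #|G| = tau x.
  have G_gt0 : 0 < #|G| by apply/card_gt0P; exists x.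
  by rewrite /L divnMDl // divn_small ?addn0.
have L_inj : injective L.
  move=> x y eqL; have := L_div x; rewrite eqL L_div => eqtau.
  by move: eqL; rewrite /L eqtau => /addnI/val_inj/enum_rank_inj.
have strongL x : #|[set y | `[< strongly_reaches r L x y >]]| <= M.
  apply: leq_trans (tau_reach x (small x)); apply/subset_leq_card/subsetP => y.
  rewrite !inE => /asboolP sxy; apply/asboolP; apply: strongly_sub sxy => a b leab.
  by rewrite -!L_div leq_div2r.
have [c cP] := greedy_coloring L (card_weakly_reaches (leqnn r) strongL).
have le_col : (M.+1 ^ r).+1 <= color_bound p d n.
  by rewrite /color_bound addn1 ltnS leq_addl.
exists (widen_ord le_col \o c); apply: td_coloring_inj (@widen_ord_inj _ _ _) _.
move=> I; apply: (treedepth_color_classes L_inj (r := r)) => //.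
move=> x y nxy xy; apply: cP; first exact/asboolP.
rewrite ltn_neqAle; apply/andP; split; first by apply: contra_neq nxy => /L_inj.
by case: xy => q [_ _ _ /andP[]].
Qed.

(** * Gluing the colourings of the members of a cover *)

Theorem proposition4 (C : graph_class) (hC : low_twin_width_covers C)
    (p : nat) (hp : 0 < p) :
  weakly_chi_bounded p C.
Proof.
have [d [m cover]] := hC p hp.
(* One coordinate for each of at most [m] members; the extra colour [None] marks vertices outside
   the member. *)
exists (fun n => (color_bound p d n).+1 ^ m) => G CG.
have [F [leF coverF twwF]] := cover G CG.
set n := class_omega _; have [TMn _] := leastP (TM_bounded p.-1 G).
pose k := color_bound p d n.
have /choice[c cP] : forall B : {set G}, exists c : G -> option 'I_k,
    B \in F -> (forall x, (c x != None) = (x \in B)) /\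
    forall I : {set 'I_k}, #|I| <= p ->
      treedepth (induced [set x | c x \in Some @: I]) <= #|I|.
  move=> B; have [BF|nBF] := boolP (B \in F); last by exists (fun=> None).
  have [H TMH|c cP] := contraction_td_coloring (n := n) hp _ (twwF B BF).
    by apply: TMn; apply: TM_subgraph TMH; exact: induced_subgraph.
  exists (fun x => omap c (insub x)) => _; split=> [x|I leI].
    by case: insubP => [x' ->//|/negPf->].
  apply: leq_trans (cP I leI); apply: treedepth_subgraph.
  have AB (x : induced [set x | omap c (insub x) \in Some @: I]) : val x \in B.
    have := valP x; rewrite inE; case: insubP => //= _.
    by case/imsetP.
  pose g x : induced B := Sub (val x) (AB x).
  have AI x : g x \in [set x | c x \in I].
    have := valP x; rewrite !inE; case: insubP => [x' _ vx' /=|]; last by rewrite AB.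
    case/imsetP=> i iI [cx]; suff -> : g x = x' by rewrite cx.
    exact: val_inj.
  exists (fun x => Sub (g x) (AI x)); split=> // x y eqg.
  by apply: val_inj; exact: (congr1 (fun z => val (val z)) eqg).
pose K := {ffun {B | B \in F} -> option 'I_k}.
pose col (x : G) : K := [ffun B => c (val B) x].
have <- : #|{ffun 'I_m -> option 'I_k}| = k.+1 ^ m.
  by rewrite card_ffun card_option !card_ord.
apply: (@leq_trans #|K|); last first.
  by rewrite !card_ffun card_option !card_ord card_sig leq_pexp2l.
apply: (chi_leq_card (c := col)) => I leI.
pose J := I :&: [set col x | x : G].
have /choice[rep repP] : forall i : K, exists o : option G,
    i \in J -> exists2 x, o = Some x & col x = i.
  move=> i; have [|ni] := boolP (i \in J); last by exists None.
  by rewrite inE => /andP[_ /imsetP[x _ ->]]; exists (Some x) => _; exists x.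
(* [X] has one representative of each colour of [I] in use. *)
pose X := [set x | Some x \in rep @: J].
have leX : #|X| <= p.
  rewrite -(card_imset X Some_inj); apply: leq_trans leI.
  apply: (@leq_trans #|rep @: J|).
    by apply/subset_leq_card/subsetP => _ /imsetP[x + ->]; rewrite inE.
  by apply: leq_trans (leq_imset_card _ _) _; apply/subset_leq_card/subsetIl.
(* As [X] lies in [B], no colour in [J] has [None] at [B], so every vertex coloured from [I] lies in
   [B]. *)
have [B BF XB] := coverF X leX.
have [cB tdB] := cP B BF.
(* Projecting to the coordinate [B] can only merge colours, so [IB] is no larger than [I] while its
   class contains that of [I]. *)
pose IB := [set i | Some i \in [set (i : K) (Sub B BF : {B | B \in F}) | i in I]].
have leIB : #|IB| <= #|I|.
  rewrite -(card_imset IB Some_inj).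
  apply: leq_trans (leq_imset_card (fun i : K => i (Sub B BF)) I).
  by apply/subset_leq_card/subsetP => _ /imsetP[x + ->]; rewrite inE.
apply: (leq_trans _ leIB); apply: leq_trans (tdB _ (leq_trans leIB leI)).
have inIB (x : induced [set x | col x \in I]) :
    val x \in [set x | c B x \in Some @: IB].
  have xI : col (val x) \in I by have := valP x; rewrite inE.
  have colE y : col y (Sub B BF) = c B y by rewrite ffunE.
  have [|x' repx colx] := repP (col (val x)); first by rewrite inE xI imset_f.
  have x'X : x' \in X.
    by rewrite inE -repx imset_f // inE xI imset_f.
  have := cB x'; rewrite (subsetP XB _ x'X) -colE colx colE inE.
  case cx: (c B (val x)) => [j|//] _; apply: imset_f; rewrite inE -cx -colE.
  exact: (imset_f (fun i : K => i (Sub B BF))).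
apply: treedepth_subgraph; exists (fun x => Sub (val x) (inIB x)).
by split=> // x y eqxy; apply: val_inj; exact: (congr1 val eqxy).
Qed.
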